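(* Let $d\ge 3$ be odd and let $n$ be an even multiple of $\frac{d-1}{2}$. Then there is a $d$-dimensional dual zonotope $Z^*\subset\mathbb{R}^d$ with $n$ zones and a projection $\pi:\mathbb{R}^d\to\mathbb{R}^2$ such that the image $\pi(Z^* )$ has at least $\left(\frac{2n}{d-1}\right)^{\frac{d-1}{2}}$ vertices.
   Context: A $d$-dimensional dual zonotope with $n$ zones is a polytope of the form $Z^*=\{x\in\mathbb{R}^d:\sum_{i=1}^n|a_ix|\le 1\}$, where $a_1,\dots,a_n$ are row vectors that span $(\mathbb{R}^d)^*$, all nonzero and no one a scalar multiple of another. A projection $\mathbb{R}^d\to\mathbb{R}^2$ is a surjective linear map. ''An even multiple of $\frac{d-1}{2}$'' means $n=2m\cdot\frac{d-1}{2}$ for a positive integer $m$.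
   Formalization: The formal statement adds the hypothesis n ≥ d, which excludes exactly the case n = d−1, where n row vectors cannot span the dual of R^d and so no d-dimensional dual zonotope with n zones exists. *)

(* Defs.v *)
From mathcomp Require Import all_boot all_order all_algebra.
From mathcomp Require Import classical_sets functions cardinality reals.

Set Implicit Arguments.
Unset Strict Implicit.
Unset Printing Implicit Defensive.

Import Order.TTheory GRing.Theory Num.Theory.
Local Open Scope classical_set_scope.
Local Open Scope ring_scope.

(* Points of R^d are column vectors and linear functionals are row vectors;
   the zones a_1, ..., a_n are the rows of A. *)
Definition admissible_zones (R : realType) (n d : nat) (A : 'M[R]_(n, d)) :
    Prop :=
  [/\ row_full A,
      forall i, row i A != 0 &
      forall i j, i != j -> forall c : R, row i A <> c *: row j A].

Definition dual_zonotope_of (R : realType) (n d : nat) (A : 'M[R]_(n, d)) :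
    set 'cV[R]_d :=
  [set x | \sum_(i < n) `|(row i A *m x) 0 0| <= 1].

Definition is_dual_zonotope (R : realType) (n d : nat) (Z : set 'cV[R]_d) :
    Prop :=
  exists2 A : 'M[R]_(n, d), admissible_zones A & Z = dual_zonotope_of A.

(* Spanning forces at least d zones. *)
Lemma is_dual_zonotope_leq (R : realType) (n d : nat) (Z : set 'cV[R]_d) :
  is_dual_zonotope n Z -> (d <= n)%N.
Proof. by case=> A [+ _ _] _ => /eqP rA; rewrite -{1}rA rank_leq_row. Qed.

Definition is_face (R : realType) (k : nat) (P F : set 'cV[R]_k) : Prop :=
  exists (c : 'rV[R]_k) (c0 : R),
    (forall x, P x -> (c *m x) 0 0 <= c0) /\
    F = P `&` [set x | (c *m x) 0 0 = c0].

Definition vertices (R : realType) (k : nat) (P : set 'cV[R]_k) :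
    set 'cV[R]_k :=
  [set v | is_face P [set v]].

(* Main.v *)
Require Import Defs.
From mathcomp Require Import all_boot all_order all_algebra.
From mathcomp Require Import classical_sets functions cardinality reals.
From mathcomp Require Import ring lra zify.

(* Write the zones in coordinates x_0, ..., x_K with K = d - 1 and project onto
   (x_0, x_K). On the chart x_0 = 1, the g-th group of m zones consists of the
   lines x_g = m (x_(g+1) - l) (l even) and x_g = m (l + 1 - x_(g+1)) (l odd),
   which together carry the zigzag x_(g+1) |-> x_g running m times across
   [0, m]. Choosing one line in each group determines a point v, and the last
   coordinate of v determines all the choices, digit by digit. The zones are
   weighted so steeply in g that, at v, multipliers of absolute value < 1 on the
   chosen zones make the signed sum of all the zones a functional of
   (x_0, x_K) alone; hence v is normalised to a point over a vertex. Balancing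
   the signs of an even group needs a zone that is positive on all these points:
   it takes the place of one zone of the group 0. Counting antipodes, this gives
   at least m^K = (m^2)^(K/2) >= (2m)^(K/2) vertices. *)

Set Implicit Arguments.
Unset Strict Implicit.
Unset Printing Implicit Defensive.

Import Order.TTheory GRing.Theory Num.Theory.
Local Open Scope classical_set_scope.
Local Open Scope card_scope.
Local Open Scope ring_scope.

(** * Vertices of a projected dual zonotope *)

(** On the dual zonotope, c P x = sum of lam_i (A x)_i <= sum of |(A x)_i| <= 1. Equality makes
    every term tight, so (A x)_i = 0 wherever |lam_i| < 1; then x is a multiple of v, and c P x = 1
    fixes the factor. *)
Lemma projected_vertex (R : realType) (n d k : nat) (A : 'M[R]_(n, d))
    (P : 'M[R]_(k, d)) (lam : 'I_n -> R) (c : 'rV[R]_k) (v : 'cV[R]_d) :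
  (forall x : 'cV_d, \sum_i lam i * (A *m x) i 0 = (c *m (P *m x)) 0 0) ->
  (forall i, `|lam i| <= 1) ->
  (forall i, lam i * (A *m v) i 0 = `|(A *m v) i 0|) ->
  (forall x : 'cV_d, (forall i, `|lam i| < 1 -> (A *m x) i 0 = 0) ->
     exists t, x = t *: v) ->
  A *m v != 0 ->
  vertices (mulmx P @` dual_zonotope_of A)
    ((\sum_i `|(A *m v) i 0|)^-1 *: (P *m v)).
Proof.
move=> lamP lam_le1 lamv ker Av0; set N := \sum_i _.
have rowE (x : 'cV[R]_d) i : (row i A *m x) 0 0 = (A *m x) i 0.
  by rewrite -row_mul mxE.
have N0 : 0 < N.
  rewrite lt_def sumr_ge0 ?andbT//; apply: contra_neq Av0 => N0.
  apply/matrixP=> i j; rewrite ord1 [RHS]mxE.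
  apply/eqP; rewrite -normr_eq0; have /eqP := N0.
  by rewrite psumr_eq0// => /allP/(_ i); rewrite mem_index_enum => /(_ isT).
have cv : (c *m (P *m v)) 0 0 = N.
  by rewrite -lamP; apply: eq_bigr => i _; rewrite lamv.
have le_norm (x : 'cV[R]_d) i : lam i * (A *m x) i 0 <= `|(A *m x) i 0|.
  apply: le_trans (ler_norm _) _; rewrite normrM ler_piMl//.
exists c, 1; split.
  move=> _ [x Zx <-]; rewrite -lamP; apply: le_trans Zx.
  by apply: ler_sum => i _; rewrite rowE le_norm.
apply/seteqP; split => [_ /= -> | _ [[x Zx <-] /=]].
  split=> /=; last first.
    by rewrite -scalemxAr mxE cv mulVf// gt_eqF.
  exists (N^-1 *: v); last by rewrite scalemxAr.
  rewrite /dual_zonotope_of /=.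
  under eq_bigr do rewrite rowE -scalemxAr mxE normrM (gtr0_norm (_ : 0 < N^-1)) ?invr_gt0//.
  by rewrite -mulr_sumr mulVf// gt_eqF.
rewrite -lamP => cx.
have tight i : lam i * (A *m x) i 0 = `|(A *m x) i 0|.
  apply/eqP; rewrite eq_le le_norm /= leNgt; apply/negP => lt_i.
  have : \sum_i lam i * (A *m x) i 0 < \sum_i `|(A *m x) i 0|.
    rewrite (bigD1 i)//= [ltRHS](bigD1 i)//= ltr_leD//.
    by apply: ler_sum => j _.
  rewrite cx ltNge; apply/negP; rewrite negbK; apply: le_trans Zx.
  by under [leRHS]eq_bigr do rewrite rowE.
have [t xE] : exists t, x = t *: v.
  apply: ker => i lam_lt1; apply/eqP; apply: contraTT lam_lt1 => Ax0.
  rewrite -leNgt -(ler_pM2r (_ : 0 < `|(A *m x) i 0|)) ?normr_gt0//.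
  by rewrite mul1r -normrM tight normr_id.
move: cx; rewrite lamP xE -!scalemxAr mxE cv => tN.
by rewrite -(mulfK (lt0r_neq0 N0) t) tN mul1r.
Qed.

(** * Zones, chosen points and multipliers *)

(* The slot of the zone that is positive on all the chosen points. *)
Definition is_cap (m g l : nat) : bool := (g == 0) && (l == m.-1).

(** [l + odd l] is the even end of [l, l + 1], where the branch [l] of the zigzag is 0; the factor
    x_0 homogenises it. The cap carries half the weight of the group i at each x_i. *)
Definition zone (R : realFieldType) (m K g l : nat) (x : nat -> R) : R :=
  if is_cap m g l then 2^-1 * \sum_(i < K) (4 * m%:R ^+ 2) ^+ i * x i
  else (4 * m%:R ^+ 2) ^+ g *
       (x g - (-1) ^+ l * m%:R * (x g.+1 - (l + odd l)%:R * x 0%N)).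

(** Each step inverts the branch [T g] of the zigzag, so that [T g] becomes the integer part of
    x_(g+1). *)
Fixpoint apex (R : realFieldType) (m : nat) (T : nat -> nat) (i : nat) : R :=
  if i is g.+1 then
    (T g)%:R + (if odd (T g) then 1 - apex R m T g / m%:R
                else apex R m T g / m%:R)
  else 1.

(* The sign at the apex of the zone [l <> j] of a group whose zone [j] is
   chosen. *)
Definition side (R : realFieldType) (j l : nat) : R := (-1) ^+ (l + (l < j)%N).

(* The value forced on the multiplier of the chosen zone of the group [g] by the
   vanishing of the coefficient of x_g: the cap contributes the 1/2, and the
   ratio of consecutive weights times the slope [m] gives [1 / (4 m)]. *)
Fixpoint pivot (R : realFieldType) (m : nat) (T : nat -> nat) (g : nat) : R :=
  if g is h.+1 then
    - 2^-1 - \sum_(l < m | l != T g :> nat) side R (T g) l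
    + (4 * m%:R)^-1 * \sum_(l < m | ~~ is_cap m h l)
        (if l == T h :> nat then pivot R m T h else side R (T h) l) * (-1) ^+ l
  else 0.

Definition multiplier (R : realFieldType) m (T : nat -> nat) (g l : nat) : R :=
  if is_cap m g l then 1
  else if l == T g then pivot R m T g else side R (T g) l.

(** * Position of the chosen points relative to the zigzags *)

Lemma apex_bounds (R : realFieldType) m T g :
  (1 < m)%N -> (forall g, T g < m)%N ->
  0 < apex R m T g < m%:R /\ (T g)%:R < apex R m T g.+1 < (T g).+1%:R.
Proof.
move=> m1 Tm.
have m0 : 0 < m%:R :> R by rewrite ltr0n ltnW.
have apexS i : 0 < apex R m T i < m%:R ->
    (T i)%:R < apex R m T i.+1 < (T i).+1%:R.
  move=> /andP[a0 am] /=; rewrite -natr1.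
  have : 0 < apex R m T i / m%:R < 1.
    by rewrite divr_gt0//= ltr_pdivrMr// mul1r.
  by case: ifP => _; lra.
suff a_in : 0 < apex R m T g < m%:R by split=> //; exact: apexS.
elim: g => [|g /apexS/andP[a0 am]]; first by rewrite /= ltr01 ltr1n.
apply/andP; split; first exact: le_lt_trans a0.
by apply: lt_le_trans am _; rewrite ler_nat.
Qed.

Lemma signrE (R : pzRingType) l : (-1) ^+ l = if odd l then -1 else 1 :> R.
Proof. by rewrite -signr_odd; case: (odd l). Qed.

Lemma apex_zigzag (R : realFieldType) m T g : (0 < m)%N ->
  apex R m T g =
  (-1) ^+ T g * m%:R * (apex R m T g.+1 - (T g + odd (T g))%:R).
Proof.
move=> m0; have mn0 : m%:R != 0 :> R by rewrite pnatr_eq0 -lt0n.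
by rewrite signrE natrD [apex _ _ _ g.+1]/=; case: (odd (T g)) => /=; field.
Qed.

(** Outside [l, l + 1] the line of the branch [l] leaves the strip between 0 and m, so every t in
    the strip lies on the same side of it. The side depends on the parity of l and on whether u is
    to the left or to the right. *)
Lemma zigzag_side (R : realFieldType) m j l (t u : R) :
  0 < t < m%:R -> j%:R < u < j.+1%:R -> l != j ->
  0 < side R j l * (t - (-1) ^+ l * m%:R * (u - (l + odd l)%:R)).
Proof.
move=> /andP[t0 tm] /andP[ju uj] lj.
rewrite /side exprD !signrE natrD.
have [ltlj|ltjl|eqlj] := ltngtP l j; last by rewrite eqlj eqxx in lj.
- have : l%:R + 1 <= j%:R :> R by rewrite natr1 ler_nat.
  by case: (odd l) => /=; nra.
- have : j%:R + 1 <= l%:R :> R by rewrite natr1 ler_nat.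
  by move: uj; rewrite -natr1; case: (odd l) => /=; nra.
Qed.

(** * Bounds and balance of the multipliers *)

(* As the sum is [-1] or [0], adding the cap's 1/2 leaves absolute value 1/2. *)
Lemma sum_side (R : realFieldType) m j : (j < m)%N ->
  \sum_(l < m | l != j :> nat) side R j l = (odd m)%:R - 1.
Proof.
move=> jm; suff H n : \sum_(l < n | l != j :> nat) side R j l =
   if (n <= j)%N then - (odd n)%:R else (odd n)%:R - 1 by rewrite H leqNgt jm.
elim: n => [|n IH]; first by rewrite big_ord0 leq0n /= oppr0.
rewrite big_mkcond big_ord_recr -big_mkcond /= IH /side exprD !signrE.
by case: (ltngtP n j) => [||->]; case: (odd _) => //=; lra.
Qed.

(** The first two terms of [pivot] add up to 1/2 or -1/2. The last is at most 1/4 in absolute value: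
    at most m terms bounded by 1, divided by 4 m. *)
Lemma pivot_norm (R : realFieldType) m T g :
  (1 < m)%N -> (forall g, T g < m)%N -> `|pivot R m T g| < 1.
Proof.
move=> m1 Tm; elim: g => [|g IH]; first by rewrite normr0.
have m0 : 0 < m%:R :> R by rewrite ltr0n ltnW.
rewrite [pivot _ _ _ _]/= sum_side//; set S := \sum_(l < m | _) _.
have Sm : `|S| <= m%:R.
  apply: (le_trans (ler_norm_sum _ _ _)).
  rewrite big_mkcond /= -[m in m%:R]card_ord -sum1_card natr_sum.
  apply: ler_sum => l _; case: ifP => // _.
  rewrite normrM normrX normrN1 expr1n mulr1.
  case: ifP => _; first exact: ltW.
  by rewrite /side normrX normrN1 expr1n.
have : `|(4 * m%:R)^-1 * S| <= 4^-1.
  rewrite normrM normfV normrM (gtr0_norm m0) (@gtr0_norm _ 4)//.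
  by rewrite invfM -mulrA ler_piMr ?invr_ge0// mulrC ler_pdivrMr// mul1r.
move: (_ * S) => s; rewrite ler_norml ltr_norml.
by case: (odd m) => /=; lra.
Qed.

Lemma pivot_balance (R : realFieldType) m T g : (T g.+1 < m)%N ->
  \sum_(l < m) multiplier R m T g.+1 l = - 2^-1 + (4 * m%:R)^-1 *
    \sum_(l < m | ~~ is_cap m g l) multiplier R m T g l * (-1) ^+ l.
Proof.
move=> Tm; rewrite (bigD1 (Ordinal Tm))//= [X in X + _]/multiplier/= eqxx.
rewrite [X in _ + X = _](eq_bigr (fun l : 'I_m => side R (T g.+1) l)); last first.
  by move=> l /negPf lT; rewrite /multiplier /= [_ == T _]lT.
have cancel_mid (a b c : R) : a - b + c + b = a + c by ring.
apply: etrans (cancel_mid _ _ _) _; congr (_ + _ * _).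
by apply: eq_bigr => l /negPf cap; rewrite /multiplier cap.
Qed.

(** For g < K, the coefficient of x_(g+1) comes only from the groups g and g + 1 and the cap;
    [pivot] makes these cancel, which is [Wbal] below. *)
Lemma multiplier_balance (R : realFieldType) m T K :
  (0 < m)%N -> (forall g, T g < m)%N ->
  exists c0 cK : R, forall x : nat -> R,
    \sum_(g < K.+1) \sum_(l < m) multiplier R m T g l * zone m K.+1 g l x =
    c0 * x 0%N + cK * x K.+1.
Proof.
move=> m0 Tm; set rho : R := 4 * m%:R ^+ 2.
pose mu g l := multiplier R m T g l.
(* Up to weight, slope and sign, [W g], [E g] and [O g] are the coefficients of x_g, x_(g+1) and x_0
   in the group g without the cap. [F] hands the i-th term of the cap to the group i. *)
pose W g := \sum_(l < m | ~~ is_cap m g l) mu g l.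
pose E g := \sum_(l < m | ~~ is_cap m g l) mu g l * (-1) ^+ l.
pose O g := \sum_(l < m | ~~ is_cap m g l)
  mu g l * (-1) ^+ l * (l + odd l)%:R.
pose F x g : R := 2^-1 * (rho ^+ g * x g) +
  rho ^+ g * (W g * x g - m%:R * E g * x g.+1 + m%:R * O g * x 0%N).
have sumF x : \sum_(g < K.+1) \sum_(l < m) mu g l * zone m K.+1 g l x =
    \sum_(g < K.+1) F x g.
  rewrite [RHS]big_split/= -mulr_sumr; set H := 2^-1 * _.
  have -> : H = \sum_(g < K.+1) \sum_(l < m | is_cap m g l) H.
    rewrite big_ord_recl [X in _ + X]big1 => [|g _]; last by rewrite big_pred0.
    have pm : (m.-1 < m)%N by rewrite prednK.
    by rewrite addr0 (big_pred1 (Ordinal pm)).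
  rewrite -big_split; apply: eq_bigr => g _ /=.
  rewrite (bigID (fun l : 'I_m => is_cap m g l))/=; congr (_ + _).
    by apply: eq_bigr => l cap; rewrite /mu/multiplier/zone cap mul1r.
  rewrite /W /E /O !mulr_suml !mulr_sumr !mulr_suml -sumrB -big_split mulr_sumr.
  by apply: eq_bigr => l /negPf cap; rewrite /zone cap /=; ring.
have Wbal g : rho ^+ g.+1 * (2^-1 + W g.+1) = rho ^+ g * m%:R * E g.
  have -> : W g.+1 = \sum_(l < m) mu g.+1 l by apply: eq_bigl.
  rewrite pivot_balance// addNKr exprSr /rho.
  have : m%:R != 0 :> R by rewrite pnatr_eq0 -lt0n.
  by move=> ?; rewrite /E /mu; field.
(* What survives the telescoping: x_0 from the group 0, the cap and the offsets of all branches, and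
   x_(K+1) from the last group. *)
exists (2^-1 + W 0%N + \sum_(g < K.+1) rho ^+ g * m%:R * O g).
exists (- (rho ^+ K * m%:R * E K)) => x; rewrite sumF.
elim: K {sumF} => [|K IH].
  by rewrite !big_ord1 /F !expr0; ring.
rewrite big_ord_recr/= IH [in RHS]big_ord_recr /= /F.
have /(congr1 (fun z => z * x K.+1)) := Wbal K.
by clearbody W E O rho; move: (\sum_(g < K.+1) _) => s; lra.
Qed.

(** * Values of the zones at an apex *)

Lemma weight_gt0 (R : realFieldType) m g : (0 < m)%N ->
  0 < (4 * m%:R ^+ 2) ^+ g :> R.
Proof. by move=> m0; rewrite exprn_gt0// mulr_gt0// exprn_gt0// ltr0n. Qed.

Lemma cap_apex_gt0 (R : realFieldType) m T K g l :
  (1 < m)%N -> (forall g, T g < m)%N -> is_cap m g l ->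
  0 < zone m K.+1 g l (apex R m T).
Proof.
move=> m1 Tm cap; rewrite /zone cap mulr_gt0 ?invr_gt0//.
have pos i : 0 < (4 * m%:R ^+ 2) ^+ i * apex R m T i.
  have [/andP[? _] _] := apex_bounds R i m1 Tm.
  by rewrite mulr_gt0// weight_gt0// ltnW.
by rewrite big_ord_recl ltr_pwDl// sumr_ge0// => i _; rewrite ltW.
Qed.

Lemma zone_apex_eq0 (R : realFieldType) m T K g l :
  (1 < m)%N -> ~~ is_cap m g l -> l = T g -> zone m K g l (apex R m T) = 0.
Proof.
move=> m1 /negPf cap lT; rewrite /zone cap lT mulr1.
by rewrite -apex_zigzag ?subrr ?mulr0// ltnW.
Qed.

Lemma side_zone_apex_gt0 (R : realFieldType) m T K g l :
  (1 < m)%N -> (forall g, T g < m)%N -> ~~ is_cap m g l -> l != T g ->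
  0 < side R (T g) l * zone m K g l (apex R m T).
Proof.
move=> m1 Tm /negPf cap lT; rewrite /zone cap mulrCA mulr_gt0//.
  by rewrite weight_gt0// ltnW.
have [? ?] := apex_bounds R g m1 Tm.
by rewrite [apex R m T 0]/= mulr1; exact: zigzag_side.
Qed.

Lemma zone_apex_neq0 (R : realFieldType) m T K g l :
  (1 < m)%N -> (forall g, T g < m)%N -> is_cap m g l || (l != T g) ->
  zone m K.+1 g l (apex R m T) != 0.
Proof.
move=> m1 Tm; case: (boolP (is_cap m g l)) => [cap _|cap /= lT].
  by rewrite gt_eqF// cap_apex_gt0.
have := side_zone_apex_gt0 R K.+1 m1 Tm cap lT.
by apply: contraTneq => ->; rewrite mulr0 ltxx.
Qed.

Lemma multiplier_zone_apex (R : realFieldType) m T K g l :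
  (1 < m)%N -> (forall g, T g < m)%N ->
  multiplier R m T g l * zone m K.+1 g l (apex R m T) =
  `|zone m K.+1 g l (apex R m T)|.
Proof.
move=> m1 Tm; rewrite /multiplier; case: (boolP (is_cap m g l)) => cap.
  by rewrite mul1r gtr0_norm// cap_apex_gt0.
case: eqP => [lT|/eqP lT]; first by rewrite zone_apex_eq0// normr0 mulr0.
have /gtr0_norm <- := side_zone_apex_gt0 R K.+1 m1 Tm cap lT.
by rewrite normrM {1}/side normrX normrN1 expr1n mul1r.
Qed.

Lemma multiplier_norm (R : realFieldType) m T g l :
  (1 < m)%N -> (forall g, T g < m)%N -> `|multiplier R m T g l| <= 1.
Proof.
move=> m1 Tm; rewrite /multiplier; case: ifP => _; first by rewrite normr1.
case: ifP => _; first exact/ltW/pivot_norm.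
by rewrite /side normrX normrN1 expr1n.
Qed.

(** * Recovering the point from its chosen zones and the digits from the point *)

(** A chosen zone that vanishes gives x_(g+1) from x_g and x_0, since its slope is nonzero; the apex
    satisfies the same recursion. *)
Lemma zones_eq0 (R : realFieldType) m T K (x : nat -> R) : (1 < m)%N ->
  (forall g, (g < K)%N -> ~~ is_cap m g (T g)) ->
  (forall g, (g < K)%N -> zone m K g (T g) x = 0) ->
  forall g, (g <= K)%N -> x g = x 0%N * apex R m T g.
Proof.
move=> m1 cap zx; elim=> [|g IH] gK; first by rewrite mulr1.
have m0 : m%:R != 0 :> R by rewrite pnatr_eq0 -lt0n ltnW.
have := zx g gK; rewrite /zone (negPf (cap g gK)) IH ?(ltnW gK)//.
have rho0 : (4 * m%:R ^+ 2) ^+ g != 0 :> R by rewrite gt_eqF// weight_gt0// ltnW.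
move=> /eqP; rewrite mulf_eq0 (negPf rho0) orFb subr_eq0 => /eqP xg.
have s0 : (-1) ^+ T g * m%:R != 0 :> R by rewrite mulf_neq0// signr_eq0.
move: xg; rewrite (apex_zigzag _ T g (ltnW m1)).
move: (apex R m T g.+1) ((-1) ^+ T g * m%:R : R) s0 => a s s0.
by move: (T g + odd (T g))%N%:R => t xg; apply: (mulfI s0); lra.
Qed.

(** The open unit interval containing the last coordinate reveals the last digit; the zigzag then
    gives back the previous coordinate. *)
Lemma apex_inj (R : realFieldType) m T T' K :
  (1 < m)%N -> (forall g, T g < m)%N -> (forall g, T' g < m)%N ->
  apex R m T K = apex R m T' K -> forall g, (g < K)%N -> T g = T' g.
Proof.
move=> m1 Tm Tm'; elim: K => [//|K IH] eq_apex.
have [_ /andP[T1 T2]] := apex_bounds R K m1 Tm.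
have [_ /andP[T1' T2']] := apex_bounds R K m1 Tm'.
have TK : T K = T' K.
  rewrite eq_apex in T1 T2; apply/eqP; rewrite eqn_leq.
  rewrite -[(T K <= _)%N]ltnS -[(T' K <= _)%N]ltnS -!(ltr_nat R).
  by rewrite (lt_trans T1)// (lt_trans T1').
move=> g; rewrite ltnS leq_eqVlt => /predU1P[->//|]; apply: IH.
by rewrite [LHS]apex_zigzag ?[RHS]apex_zigzag ?(ltnW m1)// TK eq_apex.
Qed.

(** * Counting and reindexing *)

Lemma card_le_fin (X : finType) U (B : set U) (f : X -> U) N :
  (N <= #|X|)%N -> injective f -> (forall x, B (f x)) -> `I_N #<= B.
Proof.
case: N => [|N] NX f_inj Bf; first by rewrite II0 card_ge0.
have [x0 _] : exists x0 : X, true.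
  by have /card_gt0P[x0] := leq_trans (ltn0Sn N) NX; exists x0.
pose h t := f (nth x0 (enum X) t).
have hI : {in `I_N.+1 &, injective h}.
  move=> s t /set_mem/= sN /set_mem/= tN /f_inj/eqP.
  by rewrite nth_uniq ?enum_uniq -?cardE ?(leq_trans _ NX)// => /eqP.
rewrite -(card_le_eql (inj_card_eq hI)); apply: subset_card_le => _ [t _ <-].
exact: Bf.
Qed.

Lemma sum_divn_modn (V : nmodType) n m (F : nat -> nat -> V) :
  \sum_(i < n * m) F (i %/ m)%N (i %% m)%N = \sum_(g < n) \sum_(l < m) F g l.
Proof.
rewrite -(big_mkord xpredT (fun i => F (i %/ m)%N (i %% m)%N)) big_nat_mul.
rewrite big_mkord; apply: eq_bigr => g _.
rewrite -{1}[(g * m)%N]add0n mulSn big_addn addnK big_mkord.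
apply: eq_bigr => l _.
have m0 : (0 < m)%N by case: m l => [[]|].
by rewrite addnC divnMDl// modnMDl modn_small// divn_small// addn0.
Qed.

(** * Matrix form of the zones and of the projection *)

Lemma zone_sum (R : realFieldType) (I : finType) m K g l (f : I -> nat -> R)
    (c : I -> R) :
  \sum_i zone m K g l (f i) * c i =
  zone m K g l (fun a => \sum_i f i a * c i).
Proof.
rewrite /zone; case: ifP => _.
  under eq_bigr => i _ do rewrite -mulrA mulr_suml.
  rewrite -mulr_sumr exchange_big/=; congr (_ * _); apply: eq_bigr => j _.
  by rewrite mulr_sumr; apply: eq_bigr => i _; rewrite mulrA.
under eq_bigr => i _ do rewrite -mulrA.
rewrite -mulr_sumr; congr (_ * _).
rewrite mulr_sumr -sumrB mulr_sumr -sumrB.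
by apply: eq_bigr => i _; ring.
Qed.

(** Row i is the slot [i %% m] of the group [i %/ m], evaluated on the standard basis. The last
    coordinate has index [K.+1], so the dimension is [K.+2]. *)
Definition zone_mx (R : realType) (m K : nat) : 'M[R]_(K.+1 * m, K.+2) :=
  \matrix_(i, j) zone m K.+1 (i %/ m) (i %% m) (fun a => (inord a == j)%:R).

Definition ends_mx (R : realType) (K : nat) : 'M[R]_(2, K.+2) :=
  \matrix_(i, j) (j == if i == 0 then 0 else ord_max)%:R.

Definition apex_col (R : realType) (m K : nat) (T : nat -> nat) : 'cV[R]_K.+2 :=
  \col_i apex R m T i.

Lemma zone_ext (R : realFieldType) m K g l (x y : nat -> R) : (g < K)%N ->
  (forall a, (a <= K)%N -> x a = y a) -> zone m K g l x = zone m K g l y.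
Proof.
move=> gK xy; rewrite /zone !xy ?(ltnW gK)//; case: ifP => // _.
by congr (_ * _); apply: eq_bigr => i _; rewrite xy// ltnW.
Qed.

Lemma divn_row m K (i : 'I_(K.+1 * m)) : (i %/ m < K.+1)%N /\ (i %% m < m)%N.
Proof.
case: m i => [[i]|m i]; first by rewrite muln0.
by rewrite ltn_divLR// ltn_ord ltn_pmod.
Qed.

Lemma zone_mxE (R : realType) m K (x : 'cV[R]_K.+2) i :
  (zone_mx R m K *m x) i 0 =
  zone m K.+1 (i %/ m) (i %% m) (fun a => x (inord a) 0).
Proof.
rewrite mxE; under eq_bigr do rewrite mxE.
rewrite zone_sum; apply: zone_ext => [|a _]; first by case: (divn_row i).
rewrite (bigD1 (inord a))//= eqxx mul1r big1 ?addr0// => j /negPf.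
by rewrite eq_sym => ->; rewrite mul0r.
Qed.

Lemma ends_mxE (R : realType) K (x : 'cV[R]_K.+2) (i : 'I_2) :
  (ends_mx R K *m x) i 0 = x (if i == 0 then 0 else ord_max) 0.
Proof.
rewrite mxE (bigD1 (if i == 0 then 0 else ord_max))//= mxE eqxx mul1r.
by rewrite big1 ?addr0// => j /negPf jN; rewrite mxE jN mul0r.
Qed.

Lemma ends_mx_surj (R : realType) K : range (mulmx (ends_mx R K)) = [set: 'cV_2].
Proof.
apply/seteqP; split=> // y _; exists (\col_i (if i == 0 then y 0 0 else y 1 0)) => //.
apply/matrixP=> i j; rewrite ord1 ends_mxE mxE.
by case: i => [[|[|//]] ?] /=; congr (y _ _); apply: val_inj.
Qed.

Lemma zone_mx_apex (R : realType) m K T i :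
  (zone_mx R m K *m apex_col R m K T) i 0 =
  zone m K.+1 (i %/ m) (i %% m) (apex R m T).
Proof.
rewrite zone_mxE; have [iK _] := divn_row i.
by apply: zone_ext => // a aK; rewrite mxE inordK.
Qed.

Lemma zone_mx_ker (R : realType) m K T (x : 'cV[R]_K.+2) :
  (1 < m)%N -> (forall g, T g < m)%N -> T 0%N != m.-1 ->
  (forall i : 'I_(K.+1 * m), (i %% m)%N = T (i %/ m)%N -> (zone_mx R m K *m x) i 0 = 0) ->
  x = x 0 0 *: apex_col R m K T.
Proof.
move=> m1 Tm T0 ker.
have m0 := ltnW m1.
have cap g : ~~ is_cap m g (T g) by apply/negP => /andP[/eqP -> /(negP T0)].
have zx g : (g < K.+1)%N -> zone m K.+1 g (T g) (fun a => x (inord a) 0) = 0.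
  move=> gK; have iP : (g * m + T g < K.+1 * m)%N.
    by rewrite -ltn_divLR// divnMDl// divn_small ?addn0.
  have := ker (Ordinal iP).
  rewrite zone_mxE /= divnMDl// modnMDl modn_small// divn_small// addn0.
  by apply.
apply/colP => j; rewrite !mxE -[in LHS](inord_val j).
have := zones_eq0 m1 (fun g _ => cap g) zx (ltn_ord j : (j <= K.+1)%N).
by rewrite (_ : inord 0 = 0)//; apply: val_inj; rewrite /= inordK.
Qed.

(** * Admissibility of the zones *)

(** The apex separates the zones if its digits choose [j] and avoid [i]: outside the group of [j],
    the digit is 0 or 1, whichever differs from the slot of [i]. *)
Lemma zone_mx_separated (R : realType) m K (i j : 'I_(K.+1 * m)) :
  (1 < m)%N -> i != j -> ~~ is_cap m (j %/ m) (j %% m) ->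
  exists2 v : 'cV_K.+2,
    (zone_mx R m K *m v) j 0 = 0 & (zone_mx R m K *m v) i 0 != 0.
Proof.
move=> m1 ij cap.
pose T (g : nat) := if g == (j %/ m)%N then (j %% m)%N else nat_of_bool (i %% m == 0)%N.
have Tm g : (T g < m)%N.
  rewrite /T; case: ifP => _; first by case: (divn_row j).
  by case: (_ == _) => //; rewrite ltnW.
exists (apex_col R m K T); rewrite zone_mx_apex.
  by rewrite zone_apex_eq0// /T eqxx.
rewrite zone_apex_neq0//; apply/orP; right.
rewrite /T; have [eq_div|_] := eqVneq (i %/ m)%N (j %/ m)%N; last first.
  by case: (i %% m)%N.
move: ij; apply: contra_neq => eq_mod; apply: val_inj => /=.
by rewrite (divn_eq i m) eq_div eq_mod -divn_eq.
Qed.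

Lemma zone_mx_row_neq0 (R : realType) m K i : (1 < m)%N ->
  row i (zone_mx R m K) != 0.
Proof.
move=> m1; pose T (_ : nat) := nat_of_bool (i %% m == 0)%N.
have Tm g : (T g < m)%N by rewrite /T; case: (_ == _) => //; rewrite ltnW.
have : (zone_mx R m K *m apex_col R m K T) i 0 != 0.
  rewrite zone_mx_apex zone_apex_neq0//; apply/orP; right.
  by rewrite /T; case: (i %% m)%N.
apply: contra_neq => Ai.
have := row_mul i (zone_mx R m K) (apex_col R m K T).
by rewrite Ai mul0mx => /rowP/(_ 0); rewrite !mxE.
Qed.

Lemma zone_mx_admissible (R : realType) m K : (1 < m)%N ->
  admissible_zones (zone_mx R m K).
Proof.
move=> m1; set A := zone_mx R m K.
have m0 := ltnW m1; have pm : (m.-1 < m)%N by rewrite prednK.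
have rowA i c j (v : 'cV[R]_K.+2) : row i A = c *: row j A -> (A *m v) i 0 = c * (A *m v) j 0.
  move=> Aij; have := row_mul i A v.
  by rewrite Aij -scalemxAl -row_mul => /rowP/(_ 0); rewrite !mxE.
split=> [|i|i j ij c Aij]; first last.
- have [cap|capN] := boolP (is_cap m (j %/ m) (j %% m)); last first.
    have [v vj] := zone_mx_separated R m1 ij capN.
    by rewrite (rowA _ _ _ v Aij) vj mulr0 eqxx.
  (* If [j] is the cap, then [i] is not; exchanging the roles gives c = 0, although row i is
     nonzero. *)
  have icap : ~~ is_cap m (i %/ m) (i %% m).
    move: (ij); apply: contra => /andP[/eqP i0 /eqP im]; case/andP: cap => /eqP j0 /eqP jm.
    by apply/eqP/val_inj; rewrite /= (divn_eq i m) (divn_eq j m) i0 im j0 jm.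
  have ji : j != i by rewrite eq_sym.
  have [v vi vj] := zone_mx_separated R m1 ji icap.
  have /eqP := rowA _ _ _ v Aij; rewrite vi eq_sym mulf_eq0 (negPf vj) orbF.
  move=> /eqP c0; have := zone_mx_row_neq0 R i m1.
  by rewrite -/A Aij c0 scale0r eqxx.
- exact: zone_mx_row_neq0.
(* A common zero of all zones is a multiple of the apex with all digits 0, where the cap does not
   vanish; so it is 0. *)
rewrite /row_full -mxrank_tr; apply: inj_row_free => u uA.
have Au : A *m u^T = 0 by rewrite -[LHS]trmxK trmx_mul trmxK uA trmx0.
have T0 : 0%N != m.-1 by rewrite eq_sym -lt0n -ltnS prednK.
have uE := @zone_mx_ker R m K (fun=> 0%N) u^T m1 (fun=> m0) T0.
have {}uE : u^T = u^T 0 0 *: apex_col R m K (fun=> 0%N).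
  by apply: uE => i _; rewrite Au mxE.
have iP : (m.-1 < K.+1 * m)%N by rewrite mulSn ltn_addr.
have /matrixP/(_ (Ordinal iP) 0) := Au.
rewrite uE -scalemxAr [LHS]mxE zone_mx_apex [RHS]mxE /= => /eqP.
rewrite mulf_eq0 orbC (negPf (zone_apex_neq0 R K m1 (fun=> m0) _)) /=; last first.
  by rewrite divn_small// modn_small// /is_cap !eqxx.
by move=> /eqP u0; apply: trmx_inj; rewrite uE u0 scale0r trmx0.
Qed.

(** * Vertices over the chosen points, and their number *)

(** [projected_vertex] is applied to the apex and its multipliers, both with the sign of [b]. By
    [T 0 != m.-1], the group 0 also has a chosen zone with multiplier below 1 in absolute value. *)
Lemma zone_mx_vertex (R : realType) m K T (b : bool) : (1 < m)%N ->
  (forall g, T g < m)%N -> T 0%N != m.-1 ->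
  vertices (mulmx (ends_mx R K) @` dual_zonotope_of (zone_mx R m K))
    ((-1) ^+ b *: ((\sum_i `|(zone_mx R m K *m apex_col R m K T) i 0|)^-1 *:
       (ends_mx R K *m apex_col R m K T))).
Proof.
move=> m1 Tm T0; set A := zone_mx R m K; set v := apex_col R m K T.
have [c0 [cK bal]] := multiplier_balance R K (ltnW m1) Tm.
pose s : R := (-1) ^+ b.
pose lam (i : 'I_(K.+1 * m)) := s * multiplier R m T (i %/ m) (i %% m).
have s1 : `|s| = 1 by rewrite normrX normrN1 expr1n.
have -> : s *: ((\sum_i `|(A *m v) i 0|)^-1 *: (ends_mx R K *m v)) =
    (\sum_i `|(A *m (s *: v)) i 0|)^-1 *: (ends_mx R K *m (s *: v)).
  rewrite -[in RHS]scalemxAr -scalemxAr !scalerA [in LHS]mulrC.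
  congr (_ * _ *: _); congr _^-1.
  by apply: eq_bigr => i _; rewrite [in RHS]mxE normrM s1 mul1r.
have Av i : (A *m v) i 0 = zone m K.+1 (i %/ m) (i %% m) (apex R m T).
  exact: zone_mx_apex.
apply: (@projected_vertex R _ _ _ A (ends_mx R K) lam
  (\row_i (s * if i == 0 then c0 else cK))).
- move=> x; rewrite [RHS]mxE !big_ord_recl big_ord0 !ends_mxE !mxE/= addr0.
  under eq_bigr do rewrite zone_mxE -mulrA.
  rewrite -mulr_sumr (sum_divn_modn _ _
    (fun g l => multiplier R m T g l * zone m K.+1 g l (fun a => x (inord a) 0))).
  rewrite bal mulrDr !mulrA; congr (_ * x _ _ + _ * x _ _).
    by apply: val_inj; rewrite /= inordK.
  by apply: val_inj; rewrite /= inordK.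
- by move=> i; rewrite normrM s1 mul1r multiplier_norm.
- move=> i; rewrite -scalemxAr [in LHS]mxE [in RHS]mxE Av normrM s1 mul1r.
  by rewrite mulrACA -expr2 sqrr_sign mul1r multiplier_zone_apex.
- move=> x xker; exists (s * x 0 0); rewrite scalerA mulrAC -expr2 sqrr_sign mul1r.
  apply: zone_mx_ker => // i iT; apply: xker.
  rewrite normrM s1 mul1r /multiplier ifF ?iT ?eqxx ?pivot_norm//.
  by apply/negP => /andP[/eqP -> /(negP T0)].
- have iP : (m.-1 < K.+1 * m)%N by rewrite mulSn ltn_addr// prednK// ltnW.
  apply/eqP => /matrixP/(_ (Ordinal iP) 0); rewrite -scalemxAr [LHS]mxE Av mxE /=.
  apply/eqP; rewrite mulf_neq0 ?signr_eq0//.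
  have pm : (m.-1 < m)%N by rewrite prednK// ltnW.
  by rewrite zone_apex_neq0// divn_small// modn_small// /is_cap !eqxx.
Qed.

(* The value [m.-1] at 0 is not available for the group 0, whose slot [m.-1] is
   the cap; it encodes the antipode of the point with value 0 there. *)
Definition apex_code m K (f : {ffun 'I_K.+1 -> 'I_m}) (g : nat) : nat :=
  if (g == 0)%N && (f ord0 == m.-1 :> nat) then 0%N else f (inord g).

Lemma apex_code_inj m K (f f' : {ffun 'I_K.+1 -> 'I_m}) :
  (f ord0 == m.-1 :> nat) = (f' ord0 == m.-1 :> nat) ->
  (forall g, (g < K.+1)%N -> apex_code f g = apex_code f' g) -> f = f'.
Proof.
move=> top code; apply/ffunP => g; apply: val_inj => /=.
have := code g (ltn_ord g); rewrite /apex_code top inord_val.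
case: ifP => // /andP[/eqP g0 /eqP f'0] _.
have -> : g = ord0 by apply: val_inj.
by rewrite f'0; apply/eqP; rewrite top f'0.
Qed.

(** The first coordinate of the vertex is 1 / N up to sign, which reveals the antipode bit and N;
    the second then gives the last apex coordinate, hence all digits. *)
Lemma zone_mx_card_vertices (R : realType) m K : (1 < m)%N ->
  `I_(m ^ K.+1) #<=
  vertices (mulmx (ends_mx R K) @` dual_zonotope_of (zone_mx R m K)).
Proof.
move=> m1; have m0 := ltnW m1.
pose T (f : {ffun 'I_K.+1 -> 'I_m}) := apex_code f.
pose N f : R := \sum_i `|(zone_mx R m K *m apex_col R m K (T f)) i 0|.
pose F (f : {ffun 'I_K.+1 -> 'I_m}) := (-1) ^+ (f ord0 == m.-1 :> nat) *:
  ((N f)^-1 *: (ends_mx R K *m apex_col R m K (T f))).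
have Tm f g : (T f g < m)%N by rewrite /T /apex_code; case: ifP.
have T0 f : T f 0%N != m.-1.
  rewrite /T /apex_code /=; case: ifP => [_|]; first by rewrite eq_sym -lt0n -ltnS prednK.
  by rewrite (_ : inord 0 = ord0) => [->//|]; apply: val_inj; rewrite /= inordK.
have N0 f : 0 < N f.
  have iP : (m.-1 < K.+1 * m)%N by rewrite mulSn ltn_addr// prednK.
  rewrite /N (bigD1 (Ordinal iP))//= ltr_pwDl ?sumr_ge0// normr_gt0 zone_mx_apex.
  have pm : (m.-1 < m)%N by rewrite prednK.
  rewrite (zone_apex_neq0 R K m1 (Tm f))//.
  by rewrite /= divn_small// modn_small// /is_cap !eqxx.
have F0E f : F f 0 0 = (-1) ^+ (f ord0 == m.-1 :> nat) * (N f)^-1.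
  by rewrite /F mxE [X in _ * X]mxE ends_mxE mxE mulr1.
have F1E f : F f 1 0 =
    (-1) ^+ (f ord0 == m.-1 :> nat) * ((N f)^-1 * apex R m (T f) K.+1).
  by rewrite /F mxE [X in _ * X]mxE ends_mxE mxE.
apply: (@card_le_fin _ _ _ F); first by rewrite card_ffun !card_ord.
- move=> f f' FF.
  have F0 : F f 0 0 = F f' 0 0 by rewrite FF.
  have F1 : F f 1 0 = F f' 1 0 by rewrite FF.
  rewrite !F0E in F0; rewrite !F1E in F1.
  have top : (f ord0 == m.-1 :> nat) = (f' ord0 == m.-1 :> nat).
    have := N0 f; have := N0 f'; rewrite -[in X in X -> _]invr_gt0 -[0 < N f]invr_gt0.
    by move: F0; do 2![case: (_ == _)]; rewrite //= !expr0 expr1 => F0; lra.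
  rewrite top in F0 F1.
  have s0 : (-1) ^+ (f' ord0 == m.-1 :> nat) != 0 :> R by rewrite signr_eq0.
  have N1 : (N f')^-1 != 0 by rewrite invr_eq0 gt_eqF.
  move: (mulfI s0 F0) (mulfI s0 F1) => -> /(mulfI N1)/(apex_inj m1 (Tm f) (Tm f')).
  exact: apex_code_inj.
- by move=> f; apply: zone_mx_vertex => //; exact: Tm.
Qed.

(** * Choice of the parameters *)

(* Both divisions by 2 and by d - 1 are exact under the hypotheses.
   The bound d <= n excludes only n = d - 1, for which n vectors cannot span
   (see is_dual_zonotope_leq). *)
Theorem theorem3p1 (R : realType) (d n : nat)
  (d_ge3 : (3 <= d)%N) (d_odd : odd d)
  (n_mult : exists2 m : nat, (0 < m)%N & n = (2 * m * ((d - 1) %/ 2))%N)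
  (n_ged : (d <= n)%N) :
  exists (Z : set 'cV[R]_d) (pi : {linear 'cV[R]_d -> 'cV[R]_2}),
    [/\ is_dual_zonotope n Z,
        range pi = [set: 'cV[R]_2] &
        `I_(((2 * n) %/ (d - 1)) ^ ((d - 1) %/ 2)) #<= vertices (pi @` Z)].
Proof.
have [m m0 nE] := n_mult.
have [k dE] : exists k, d = k.*2.+3.
  by exists d./2.-1; have := odd_double_half d; rewrite d_odd; lia.
have half_d : ((d - 1) %/ 2)%N = k.+1 by rewrite dE; lia.
have nE' : n = (k.*2.+2 * m)%N by rewrite nE half_d; lia.
(* For m = 1, n would be d - 1. *)
have m1 : (1 < m)%N.
  by rewrite ltnNge; apply/negP => m_le1; move: n_ged; rewrite nE' dE; nia.
have -> : ((2 * n) %/ (d - 1))%N = (2 * m)%N.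
  by rewrite nE' dE subn1 /= mulnCA mulKn.
rewrite half_d; move: {n_mult n_ged nE half_d} nE'.
rewrite {d_ge3 d_odd}dE => ->.
exists (dual_zonotope_of (zone_mx R m k.*2.+1)), (mulmx (ends_mx R k.*2.+1)).
split; first by exists (zone_mx R m k.*2.+1) => //; exact: zone_mx_admissible.
  exact: ends_mx_surj.
apply: card_le_trans (zone_mx_card_vertices R k.*2.+1 m1).
(* Here 2 m <= m^2, because m >= 2. *)
by rewrite card_le_II -doubleS -mul2n expnM leq_exp2r// expnS expn1 leq_mul2r m1 orbT.
Qed.
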